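(* If $A$ is a unary algebra with finitely many $\mathscr G$-classes, $G_1,\ldots,G_k$, then \[ \mathrm{Ht}(\mathrm{Cong}(A)) = \sum_{r=1}^k \mathrm{Ht}(\mathrm{Cong}(\overline{G}_r)) - k. \]
   Context: The height $\mathrm{Ht}(P)$ of a poset $P$ is the supremum of the cardinalities of chains in $P$. A unary algebra is a set $A$ (in principle allowed to be empty) together with an indexed family of basic operations, all of arity $1$, i.e. maps $A\to A$. A congruence of $A$ is an equivalence relation $\sigma$ on $A$ such that $(a,b)\in\sigma$ implies $(f(a),f(b))\in\sigma$ for every basic operation $f$; $\mathrm{Cong}(A)$ is the lattice of all congruences of $A$ ordered by inclusion. For $a\in A$, $\langle a\rangle$ denotes the subalgebra of $A$ generated by $a$. The equivalence relation $\mathscr G$ on $A$ is defined by $a\mathrel{\mathscr G}b\Leftrightarrow\langle a\rangle=\langle b\rangle$, and its equivalence classes are called the $\mathscr G$-classes of $A$. For a subset $X\subseteq A$, the principal factor $\overline X$ is the algebra of the same signature as $A$ with underlying set $X\cup\{0\}$, where $0$ is a symbol not belonging to $A$, in which each basic operation $f$ is interpreted as $\overline f$ given by $\overline f(x)=f(x)$ if $x\in X$ and $f(x)\in X$, and $\overline f(x)=0$ otherwise.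
   Formalization: The unary algebra A is assumed nonempty (k ≥ 1); for A empty the formula fails, since Cong(A) has one element and so height 1, while the right-hand side is 0. *)

(* Defs.v *)
From HB Require Import structures.
From mathcomp Require Import all_boot all_order.
From mathcomp Require Import boolp classical_sets functions cardinality.

Set Implicit Arguments.
Unset Strict Implicit.
Unset Printing Implicit Defensive.

Import Order.TTheory.

Local Open Scope classical_set_scope.
Local Open Scope card_scope.

(* A cardinal is an equipotence class of types. Classes are predicates of type
   [Type -> Prop] rather than [set Type]: the latter is a universe
   inconsistency, because [set _] is itself a choiceType. *)
Definition equipotent (T U : Type) : Prop := [set: T] #= [set: U].

Definition cardinal := {c : Type -> Prop | exists T, c = equipotent T}.

Definition card_of (T : Type) : cardinal :=
  exist _ (equipotent T) (ex_intro _ T erefl).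

Definition crepr (c : cardinal) : Type := sval (cid (svalP c)).

Definition cle (c d : cardinal) : Prop := [set: crepr c] #<= [set: crepr d].

Definition czero : cardinal := card_of void.

Definition cadd (c d : cardinal) : cardinal := card_of (crepr c + crepr d)%type.

Lemma creprK (c : cardinal) : card_of (crepr c) = c.
Proof.
rewrite /crepr; case: cid => T; case: c => c cT /= cE.
by apply: eq_exist; rewrite cE.
Qed.

Lemma card_of_eqE (T U : Type) :
  card_of T = card_of U <-> [set: T] #= [set: U].
Proof.
split=> [[TU]|TU].
  suff: equipotent T U by [].
  by rewrite TU /equipotent card_eqxx.
apply: eq_exist; apply/funext => V; apply/propext; split => h.
  by apply: card_eq_trans h; rewrite card_eq_sym.
exact: card_eq_trans h.
Qed.

Lemma crepr_card_of (T : Type) : [set: crepr (card_of T)] #= [set: T].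
Proof. by apply/card_of_eqE; rewrite creprK. Qed.

Lemma cle_card_of (T U : Type) :
  cle (card_of T) (card_of U) <-> [set: T] #<= [set: U].
Proof.
by rewrite /cle (card_le_eql (crepr_card_of T))
  (card_le_eqr (crepr_card_of U)).
Qed.

Lemma cle_trans (c d e : cardinal) : cle c d -> cle d e -> cle c e.
Proof. exact: card_le_trans. Qed.

Lemma card_leTT (T U : Type) (f : T -> U) :
  injective f -> [set: T] #<= [set: U].
Proof.
move=> finj; have : [set: f @` setT] #= [set: T].
  by rewrite (card_eql (card_setT _)); apply: inj_card_eq => x y _ _ /finj.
move=> /card_eqPle[_ h]; apply: (card_le_trans h).
by rewrite (card_le_eql (card_setT _)); exact: card_leT.
Qed.

Lemma card_leTTP (T U : Type) : [set: T] #<= [set: U] ->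
  exists f : T -> U, injective f.
Proof.
move=> /card_leP[f]; exists (fun x => val (f (SigSub (in_setT x)))).
move=> x y /val_inj h.
by have [] : SigSub (in_setT x) = SigSub (in_setT y) :> [set: T]
  by apply: ('inj_f) => //; rewrite in_setT.
Qed.

(* Among the types [T j] one embeds in all the others: apply Zorn's lemma to
   the subsets of their product on which every projection is injective. *)
Lemma least_card (J : Type) (T : J -> Type) (j0 : J) :
  exists i, forall j, [set: T i] #<= [set: T j].
Proof.
pose P := forall j, T j.
pose good (S : set P) :=
  forall j (p q : P), S p -> S q -> p j = q j -> p = q.
have [S [Sgood Smax]] : exists S, good S /\ forall S', S `<` S' -> ~ good S'.
  apply: Zorn_bigcup => F Fgood Ftot j p q [X FX Xp] [Y FY Yq].
  have [XY|YX] := Ftot _ _ FX FY.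
    by apply: (Fgood _ FY) => //; exact: XY.
  by apply: (Fgood _ FX) => //; exact: YX.
have [i isurj] : exists i, forall t : T i, exists2 p, S p & p i = t.
  apply: contrapT => /forallNP noi.
  have mis j : exists t : T j, forall p, S p -> p j <> t.
    apply: contrapT => /forallNP h; apply: (noi j) => t.
    apply: contrapT => h'; apply: (h t) => p Sp pt; apply: h'.
    by exists p.
  pose p0 : P := fun j => sval (cid (mis j)).
  have p0P j p : S p -> p j <> p0 j by exact: (svalP (cid (mis j))).
  apply: (Smax (S `|` [set p0])).
    split=> [|h]; first by move=> p Sp; left.
    by apply: (p0P j0 p0) => //; apply: h; right.
  move=> j p q [Sp|->] [Sq|->] // pq.
  - exact: Sgood pq.
  - by case: (p0P j p Sp).
  - by case: (p0P j q Sq).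
exists i => j.
pose f t := sval (cid2 (isurj t)).
have fS t : S (f t) by rewrite /f; case: cid2.
have fi t : f t i = t by rewrite /f; case: cid2.
apply: (@card_leTT _ _ (fun t => f t j)) => t u tu.
by rewrite -(fi t) -(fi u) (Sgood _ _ _ (fS t) (fS u) tu).
Qed.

Lemma cardinal_least (Q : cardinal -> Prop) : (exists c, Q c) ->
  exists c, Q c /\ forall d, Q d -> cle c d.
Proof.
move=> [c0 Qc0]; pose B := {X : set (crepr c0) | Q (card_of X)}.
have QT : Q (card_of [set: crepr c0]).
  suff -> : card_of [set: crepr c0] = c0 by [].
  by rewrite -[RHS]creprK; apply/card_of_eqE; exact: card_setT.
have [i ile] :=
  @least_card B (fun b => set_type (sval b)) (exist _ setT QT).
exists (card_of (sval i)); split=> [|d Qd]; first exact: svalP i.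
have [] := @least_card bool
  (fun b => if b then set_type (sval i) else crepr d) true.
case=> /(_ _) h.
  by rewrite -[d]creprK; apply/cle_card_of; exact: (h false).
have [f finj] := card_leTTP (card_le_trans (h true) (card_leT _)).
have [g ginj] : exists g : crepr d -> crepr c0, injective g.
  have [g ginj] := card_leTTP (h true).
  by exists (fun x => val (g x)) => x y /val_inj /ginj.
have dE : card_of (g @` setT) = d.
  rewrite -[RHS]creprK; apply/card_of_eqE; rewrite (card_eql (card_setT _)).
  by apply: inj_card_eq => x y _ _ /ginj.
have Qg : Q (card_of (g @` setT)) by rewrite dE.
by rewrite -dE; apply/cle_card_of; exact: (ile (exist _ _ Qg)).
Qed.

Definition cmin (Q : cardinal -> Prop) (Q0 : exists c, Q c) : cardinal :=
  sval (cid (cardinal_least Q0)).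

Lemma csup_bounded (J : Type) (F : J -> cardinal) :
  exists c, forall j, cle (F j) c.
Proof.
exists (card_of {j & crepr (F j)}) => j.
rewrite -[F j]creprK; apply/cle_card_of.
apply: (@card_leTT _ _ (fun x => existT (fun j => crepr (F j)) j x)).
move=> x y xy; have := projT2_eq xy.
by rewrite (Prop_irrelevance (projT1_eq xy) erefl).
Qed.

Definition csup (J : Type) (F : J -> cardinal) : cardinal :=
  cmin (csup_bounded F).

Lemma csup_ub (J : Type) (F : J -> cardinal) (j : J) : cle (F j) (csup F).
Proof. by rewrite /csup /cmin; case: cid => c /= [+ _]; apply. Qed.

Lemma csup_le (J : Type) (F : J -> cardinal) (d : cardinal) :
  (forall j, cle (F j) d) -> cle (csup F) d.
Proof. by rewrite /csup /cmin; case: cid => c /= [_]; apply. Qed.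

Lemma csub_bounded (c : cardinal) (n : nat) :
  exists d, cle c (cadd d (card_of 'I_n)).
Proof.
exists c; rewrite -{1}[c]creprK; apply/cle_card_of.
by apply: (@card_leTT _ _ inl) => x y [].
Qed.

(* Subtraction of a finite cardinal, as the least [d] with [c <= d + n]: it is
   truncated for [c < n], and [c - n = c] for infinite [c]. *)
Definition csub (c : cardinal) (n : nat) : cardinal := cmin (csub_bounded c n).

Declare Scope cardinal_scope.
Delimit Scope cardinal_scope with cardinal.
Bind Scope cardinal_scope with cardinal.
Notation "c - n" := (csub c n) : cardinal_scope.
Notation "\sum_ ( i < n ) F" := (\big[cadd/czero]_(i < n) F) : cardinal_scope.

Definition chain d (P : porderType d) (C : set P) : Prop :=
  total_on C (fun x y : P => (x <= y)%O).

Definition Ht d (P : porderType d) : cardinal :=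
  csup (fun C : {C : set P | chain C} => card_of (sval C)).

Record unary_algebra (I : Type) := UnaryAlgebra {
  carrier :> Type;
  op : I -> carrier -> carrier }.

Section UnaryAlgebra.
Context (I : Type) (A : unary_algebra I).

Record Cong := MkCong {
  congr_rel :> A -> A -> Prop;
  congr_equiv : RelationClasses.Equivalence congr_rel;
  congr_op : forall (i : I) (a b : A),
    congr_rel a b -> congr_rel (op i a) (op i b) }.

Lemma congr_inj : injective congr_rel.
Proof.
move=> [r re ro] [s se so] /= rs; case: s / rs se so => se so.
by congr MkCong; exact: Prop_irrelevance.
Qed.

HB.instance Definition _ := gen_eqMixin Cong.
HB.instance Definition _ := gen_choiceMixin Cong.

Definition congr_le (r s : Cong) : bool :=
  `[< forall a b : A, r a b -> s a b >].

Lemma congr_le_refl : reflexive congr_le.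
Proof. by move=> r; apply/asboolP. Qed.

Lemma congr_le_anti : antisymmetric congr_le.
Proof.
move=> r s /andP[/asboolP rs /asboolP sr]; apply: congr_inj.
by apply/funext => a; apply/funext => b; apply/propext; split=> [/rs|/sr].
Qed.

Lemma congr_le_trans : transitive congr_le.
Proof.
by move=> s r t /asboolP rs /asboolP st; apply/asboolP => a b /rs /st.
Qed.

Fact congr_display : Order.disp_t. Proof. exact: Order.Disp tt tt. Qed.

HB.instance Definition _ := Order.Le_isPOrder.Build congr_display Cong
  congr_le_refl congr_le_anti congr_le_trans.

Definition subalgebra (S : set A) : Prop :=
  forall (i : I) (a : A), S a -> S (op i a).

Definition generated (a : A) : set A := smallest subalgebra [set a].

Definition Grel (a b : A) : Prop := generated a = generated b.

Definition Gclasses : set (set A) := [set [set b | Grel a b] | a in [set: A]].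

(* [None] is the extra element 0. *)
Definition principal_op (X : set A) (i : I) (x : option X) : option X :=
  if x is Some y then insub (op i (val y)) else None.

Definition principal_factor (X : set A) : unary_algebra I :=
  UnaryAlgebra (@principal_op X).

End UnaryAlgebra.

Arguments Gclasses {I} A.

(* Main.v *)
From HB Require Import structures.
Require Import Defs.
From mathcomp Require Import all_boot all_order.
From mathcomp Require Import boolp classical_sets functions cardinality.

Set Implicit Arguments.
Unset Strict Implicit.
Unset Printing Implicit Defensive.

Local Open Scope classical_set_scope.
Local Open Scope card_scope.
Import Order.TTheory.

(** Rank the G-classes by an injective [rank] along which operations never
raise the rank of the class of an element, and let A_{<r} denote the elements whose
class has rank below that of r: a subalgebra, empty for the class [r0] of least
rank. Two families of monotone maps relate the congruences of A to those of the
principal factors.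

- [lift_congr r] sends a congruence of the r-th factor to the one that glues
  A_{<r} into a single block, standing for 0, and leaves the elements of higher
  rank alone. Any lift from a class of lower rank is contained in any lift from
  a class of higher rank, so chains in the factors, once lifted, stack up into
  one chain of Cong(A). The lift of the least congruence of a factor only
  duplicates a congruence that belongs to the classes below. For r = r0 the
  block A_{<r} is empty and it is the greatest congruence that is redundant: it
  is the only one that relates 0 to something else. Leaving out these k
  redundant congruences, lifting is injective ([sum_chains_le]).
- [res_congr r] sends a congruence s of A to the one it induces on the r-th
  factor, where an element is merged with 0 when s relates it to A_{<r}.
  Together these maps separate comparable congruences ([res_congr_inj]). Along
  a chain C, each s other than equality therefore changes some coordinate with
  respect to all the smaller members of C ([chain_new_coordinate]), and s can be
  encoded by that coordinate and its value there. Equality is encoded by the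
  greatest congruence of the factor of r0, which is never a restriction. The
  codes avoid the least congruence of each of the k factors ([chain_le]).

So |C| + k is at most the sum of the heights of the factors, for each chain C,
and the sum of the sizes of any chains in the factors is at most Ht(Cong A) + k.
Cancelling the finite cardinal k in the first inequality bounds Ht(Cong A) by
the difference. In the second one the suprema have to be moved out of the sum
one at a time, which rests on c + c = c for infinite c ([csum_csup_le]). *)

(** * Cardinal arithmetic *)

Lemma cardinal_ind (P : cardinal -> Prop) :
  (forall T, P (card_of T)) -> forall c, P c.
Proof. by move=> PT c; rewrite -(creprK c). Qed.

Lemma cleP (T U : Type) :
  cle (card_of T) (card_of U) <-> exists f : T -> U, injective f.
Proof.
by rewrite cle_card_of; split=> [/card_leTTP|[f /card_leTT]].
Qed.

Lemma cle_refl (c : cardinal) : cle c c.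
Proof. exact: card_lexx. Qed.

Lemma cle_anti (c d : cardinal) : cle c d -> cle d c -> c = d.
Proof.
move=> cd dc; rewrite -(creprK c) -(creprK d); apply/card_of_eqE.
exact: Cantor_Bernstein.
Qed.

Lemma card_of_bij (T U : Type) (f : T -> U) :
  injective f -> (forall u, exists t, f t = u) -> card_of T = card_of U.
Proof.
move=> finj /choice[g gK]; apply: cle_anti; apply/cleP; first by exists f.
by exists g; exact: can_inj gK.
Qed.

Lemma cle_sum (T T' U U' : Type) :
  cle (card_of T) (card_of T') -> cle (card_of U) (card_of U') ->
  cle (card_of (T + U)%type) (card_of (T' + U')%type).
Proof.
move=> /cleP[f finj] /cleP[g ginj]; apply/cleP.
exists (fun x => match x with inl a => inl (f a) | inr b => inr (g b) end).
by move=> [a|a] [b|b] // [] => [/finj|/ginj] ->.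
Qed.

Lemma cadd_mono (c c' d d' : cardinal) :
  cle c c' -> cle d d' -> cle (cadd c d) (cadd c' d').
Proof. by move=> cc' dd'; apply: cle_sum; rewrite !creprK. Qed.

Lemma cadd_card_of (T U : Type) :
  cadd (card_of T) (card_of U) = card_of (T + U)%type.
Proof.
by apply: cle_anti; apply: cle_sum; rewrite creprK; exact: cle_refl.
Qed.

Lemma caddC : commutative cadd.
Proof.
move=> c d; elim/cardinal_ind: c => T; elim/cardinal_ind: d => U.
rewrite !cadd_card_of.
apply: (@card_of_bij _ _
  (fun x => match x with inl a => inr a | inr b => inl b end)).
  by move=> [?|?] [?|?] // [->].
by case=> a; [exists (inr a)|exists (inl a)].
Qed.

Lemma caddA : associative cadd.
Proof.
move=> c d e; elim/cardinal_ind: c => T; elim/cardinal_ind: d => U.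
elim/cardinal_ind: e => V; rewrite !cadd_card_of.
pose f (x : T + (U + V)) : T + U + V := match x with
  | inl a => inl (inl a) | inr (inl b) => inl (inr b) | inr (inr c) => inr c
  end.
apply: (@card_of_bij _ _ f); first by move=> [?|[?|?]] [?|[?|?]] // [->].
by case=> [[a|b]|c]; [exists (inl a)|exists (inr (inl b))|exists (inr (inr c))].
Qed.

Lemma cadd0c : left_id czero cadd.
Proof.
move=> c; elim/cardinal_ind: c => T; rewrite /czero cadd_card_of.
apply: esym; apply: (@card_of_bij _ _ inr) => [? ? []//|[[]|t]].
by exists t.
Qed.

HB.instance Definition _ :=
  Monoid.isComLaw.Build cardinal czero cadd caddA caddC cadd0c.

Lemma cle0c (c : cardinal) : cle czero c.
Proof.
by elim/cardinal_ind: c => T; apply/cleP; exists (of_void T); case.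
Qed.

Lemma card_of_empty (T : Type) : (T -> False) -> card_of T = czero.
Proof.
move=> T0; apply: cle_anti (cle0c _); apply/cleP.
by exists (fun t => False_rect _ (T0 t)) => t; case: (T0 t).
Qed.

Lemma existT_inj (J : Type) (T : J -> Type) (j : J) : injective (existT T j).
Proof.
move=> x y xy; have := projT2_eq xy.
by rewrite (Prop_irrelevance (projT1_eq xy) erefl).
Qed.

Lemma csum_card_of (n : nat) (T : 'I_n -> Type) :
  \big[cadd/czero]_(r < n) card_of (T r) = card_of {r & T r}.
Proof.
elim: n T => [|n IHn] T.
  by rewrite big_ord0 card_of_empty // => -[[]].
rewrite big_ord_recl IHn cadd_card_of.
pose f (x : T ord0 + {s : 'I_n & T (lift ord0 s)}) : {r & T r} :=
  match x with
  | inl a => existT T ord0 a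
  | inr s => existT T (lift ord0 (projT1 s)) (projT2 s)
  end.
apply: (@card_of_bij _ _ f) => [|[r]].
  move=> [a|[r a]] [b|[s b]] //= e; first by rewrite (existT_inj e).
  have rs : r = s by apply: (@lift_inj _ ord0); exact: (congr1 (@projT1 _ _) e).
  by case: s / rs b e => b e; rewrite (existT_inj e).
case: (unliftP ord0 r) => [s ->|->] a; first by exists (inr (existT _ s a)).
by exists (inl a).
Qed.

(** One point at a time: an injection f from T + 1 to U + 1 gives one from T to
U, after redirecting to f(inr tt) the only element that f may send outside of
U. *)
Lemma cadd_ord_cancel (c d : cardinal) (n : nat) :
  cle (cadd c (card_of 'I_n)) (cadd d (card_of 'I_n)) -> cle c d.
Proof.
elim: n => [|n IHn] in c d *.
  by rewrite card_of_empty ?(caddC _ czero) ?cadd0c // => -[].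
have -> : card_of 'I_n.+1 = cadd (card_of unit) (card_of 'I_n).
  rewrite cadd_card_of; apply: cle_anti; apply/cleP.
    exists (fun i => if unlift ord0 i is Some j then inr j else inl tt).
    move=> i j.
    by case: unliftP => [i' ->|->]; case: unliftP => [j' ->|->] // [->].
  exists (fun x => if x is inr j then lift ord0 j else ord0).
  by move=> [[]|i] [[]|j] // /lift_inj ->.
rewrite !caddA => /IHn; elim/cardinal_ind: c => T; elim/cardinal_ind: d => U.
rewrite !cadd_card_of => /cleP[f finj]; apply/cleP.
have [g gP] : {g : T -> U & forall t, f (inl t) = inl (g t) \/
    f (inl t) = inr tt /\ f (inr tt) = inl (g t)}.
  apply/(@choice _ _ (fun t u => f (inl t) = inl u \/
    f (inl t) = inr tt /\ f (inr tt) = inl u)) => t.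
  case ft: (f (inl t)) => [u|[]]; first by exists u; left.
  case fn: (f (inr tt)) => [u|[]]; first by exists u; right.
  by have := finj (inl t) (inr tt); rewrite ft fn => /(_ erefl).
exists g => t t' gE.
have [ft|[ft fn]] := gP t; have [ft'|[ft' fn']] := gP t'.
- by have [] : inl t = inl t' :> T + unit by apply: finj; rewrite ft ft' gE.
- by have := finj (inl t) (inr tt); rewrite ft fn' gE => /(_ erefl).
- by have := finj (inl t') (inr tt); rewrite ft' fn gE => /(_ erefl).
- by have [] : inl t = inl t' :> T + unit by apply: finj; rewrite ft ft'.
Qed.

Lemma csub_le (c d : cardinal) (n : nat) :
  cle c (cadd d (card_of 'I_n)) -> cle (csub c n) d.
Proof. by rewrite /csub /cmin; case: cid => e /= [_]; apply. Qed.

Lemma csubK (c : cardinal) (n : nat) : cle c (cadd (csub c n) (card_of 'I_n)).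
Proof. by rewrite /csub /cmin; case: cid => e /= []. Qed.

Lemma cfiniteP (c : cardinal) :
  (exists n, c = card_of 'I_n) \/ cle (card_of nat) c.
Proof.
elim/cardinal_ind: c => T; have [[n Tn]|Tinf] := EM (finite_set [set: T]).
  left; exists n; apply/card_of_eqE; apply: card_eq_trans Tn _.
  exact: card_II.
by right; apply/cle_card_of/infiniteP.
Qed.

Lemma cle_ord (m n : nat) : cle (card_of 'I_m) (card_of 'I_n) <-> (m <= n)%N.
Proof.
rewrite cle_card_of -(card_le_eql card_II) -(card_le_eqr card_II).
by rewrite card_le_II.
Qed.

Lemma cle_ordP (c : cardinal) (n : nat) : cle c (card_of 'I_n) ->
  exists2 m, (m <= n)%N & c = card_of 'I_m.
Proof.
have [[m ->] /cle_ord mn|cinf cn] := cfiniteP c; first by exists m.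
have := cle_trans cinf cn; rewrite cle_card_of -(card_le_eqr card_II).
by move=> /infiniteP; case; exists n.
Qed.

(** Zorn's lemma gives a maximal set S of injective sequences in T with pairwise
disjoint ranges. Only finitely many elements of T are left over, since an
infinite remainder would contain one more sequence, and one sequence of S can
make room for them. *)
Lemma cinf_decomp (T : Type) : [set: nat] #<= [set: T] ->
  exists F : Type, card_of T = card_of (F * nat)%type.
Proof.
move=> Tinf.
pose P (S : set (nat -> T)) := forall f g m n,
  S f -> S g -> f m = g n -> f = g /\ m = n.
have [S [SP Smax]] : exists S, P S /\ forall S', S `<` S' -> ~ P S'.
  apply: Zorn_bigcup => F FP Ftot f g m n [X FX Xf] [Y FY Yg].
  have [XY|YX] := Ftot _ _ FX FY.
    by apply: (FP _ FY) => //; exact: XY.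
  by apply: (FP _ FX) => //; exact: YX.
pose rest := [set t | forall f n, S f -> f n <> t].
have restfin : finite_set rest.
  apply: contrapT => /infiniteP /card_leP[h].
  pose h' n := val (h (SigSub (in_setT n))).
  have h'inj : injective h'.
    move=> m n /val_inj hmn.
    by have [] : SigSub (in_setT m) = SigSub (in_setT n) :> [set: nat]
      by apply: ('inj_h) => //; rewrite in_setT.
  have h'rest n : rest (h' n) by apply: set_valP.
  apply: (Smax (S `|` [set h'])).
    split=> [|sub]; first by move=> f Sf; left.
    have Sh' : S h' by apply: sub; right.
    exact: (h'rest 0 h' 0 Sh').
  move=> f g m n [Sf|->] [Sg|->] fg.
  - exact: SP fg.
  - by case: (h'rest n f m Sf).
  - by case: (h'rest m g n Sg).
  - by split=> //; exact: h'inj.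
have [f0 Sf0] : S !=set0.
  apply/set0P/negP => /eqP S0; have /infiniteP := Tinf; apply.
  by apply: sub_finite_set restfin => t _ f n; rewrite S0.
have /countable_injP[q qinj] := finite_set_countable restfin.
exists (sig S); apply: cle_anti; apply/cleP; last first.
  exists (fun p => sval p.1 p.2) => -[[f Sf] m] [[g Sg] n] /=.
  move=> /(SP _ _ _ _ Sf Sg)[fg ->]; case: g / fg Sg => Sg.
  by rewrite (Prop_irrelevance Sf Sg).
(* The even places hold the elements covered by S. The odd places of the single
   sequence f0 hold the remaining ones, numbered by q. *)
pose R t (p : sig S * nat) :=
  sval p.1 (p.2)./2 = t /\ ~~ odd p.2 \/ rest t /\ p.2 = (q t).*2.+1.
have [g gR] : {g : T -> sig S * nat & forall t, R t (g t)}.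
  apply: choice => t; have [rt|] := EM (rest t).
    by exists (exist _ f0 Sf0, (q t).*2.+1); right.
  move=> /existsNP[f /existsNP[n /not_implyP[Sf /contrapT fn]]].
  by exists (exist _ f Sf, n.*2); left; rewrite /= doubleK odd_double.
exists g => t u gtu; have := gR u; have := gR t; rewrite /R -gtu.
case=> [[ft ot] [[fu _]|[_ fu]]|[rt ft] [[_ ou]|[ru]]].
- by rewrite -ft -fu.
- by move: ot; rewrite fu /= odd_double.
- by move: ou; rewrite ft /= odd_double.
- rewrite ft => e; have := double_inj (succn_inj e).
  by apply: qinj; rewrite inE.
Qed.

Lemma cadd_inf (c : cardinal) : cle (card_of nat) c -> cadd c c = c.
Proof.
elim/cardinal_ind: c => T /cle_card_of /cinf_decomp[F ->].
rewrite cadd_card_of; apply: (@card_of_bij _ _ (fun x => match x with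
  | inl p => (p.1, p.2.*2) | inr p => (p.1, p.2.*2.+1) end)).
  move=> [[f m]|[f m]] [[g n]|[g n]] /= [-> mn].
  - by rewrite (double_inj mn).
  - by move: (congr1 odd mn); rewrite /= !odd_double.
  - by move: (congr1 odd mn); rewrite /= !odd_double.
  - by rewrite (double_inj mn).
case=> f n; have := odd_double_half n.
case: (odd n) => /= <-; first by exists (inr (f, n./2)).
by exists (inl (f, n./2)).
Qed.

(** If d is infinite then both summands are below d = d + d. If d is finite then
all F j are bounded by d, so that their supremum is one of them. *)
Lemma cadd_csup_le (J : Type) (F : J -> cardinal) (c d : cardinal) :
  J -> (forall j, cle (cadd (F j) c) d) -> cle (cadd (csup F) c) d.
Proof.
move=> j0 Fcd.
have Fd j : cle (F j) d.
  apply: cle_trans (Fcd j); rewrite -{1}(cadd0c (F j)) caddC.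
  by apply: cadd_mono; [exact: cle_refl|exact: cle0c].
have cd : cle c d.
  apply: cle_trans (Fcd j0); rewrite -{1}(cadd0c c).
  by apply: cadd_mono; [exact: cle0c|exact: cle_refl].
have [[n dE]|dinf] := cfiniteP d; last first.
  by rewrite -(cadd_inf dinf); apply: cadd_mono => //; exact: csup_le.
pose P m := `[< exists j, F j = card_of 'I_m >].
have [||m /asboolP[j Fj] mmax] := @ex_maxnP P n.
- have := Fd j0; rewrite dE => /cle_ordP[m _ Fj0].
  by exists m; apply/asboolP; exists j0.
- by move=> m /asboolP[j Fj]; apply/cle_ord; rewrite -Fj -dE.
apply: cle_trans (Fcd j); apply: cadd_mono; last exact: cle_refl.
apply: csup_le => j'; have := Fd j'; rewrite dE => /cle_ordP[m' _ Fj'].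
by rewrite Fj' Fj; apply/cle_ord/mmax/asboolP; exists j'.
Qed.

Lemma csum_csup_le (k : nat) (J : 'I_k -> Type)
    (F : forall r, J r -> cardinal) (d : cardinal) :
    (forall r, inhabited (J r)) ->
    (forall j : forall r, J r, cle (\big[cadd/czero]_(r < k) F r (j r)) d) ->
  cle (\big[cadd/czero]_(r < k) csup (F r)) d.
Proof.
move=> J0 Fd.
pose value r c := exists j, c = F r j.
(* Replace the values by the suprema one index at a time, those below m being
   already replaced. *)
suff mixed m (c : 'I_k -> cardinal) :
    (forall r : 'I_k, if (r < m)%N then c r = csup (F r) else value r (c r)) ->
    cle (\big[cadd/czero]_(r < k) c r) d.
  by apply: (mixed k) => r; rewrite ltn_ord.
elim: m c => [|m IHm] c cm.
  pose j r := sval (cid (cm r)).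
  rewrite (eq_bigr (fun r => F r (j r))); first exact: Fd.
  by move=> r _; exact: svalP (cid (cm r)).
have [mk|km] := ltnP m k; last first.
  apply: IHm => r; have := cm r; rewrite (leq_trans (ltn_ord r) km).
  by rewrite (leq_trans (ltn_ord r) (leqW km)).
pose r0 := Ordinal mk.
have := cm r0; rewrite ltnSn (bigD1 r0) //= => ->.
case: (J0 r0) => j0; apply: cadd_csup_le => // j.
pose c' r := if r == r0 then F r0 j else c r.
rewrite (eq_bigr c'); last by move=> r /negPf rr0; rewrite /c' rr0.
have -> : F r0 j = c' r0 by rewrite /c' eqxx.
rewrite (_ : cadd _ _ = \big[cadd/czero]_(r < k) c' r); last first.
  by rewrite [RHS](bigD1 r0).
apply: IHm => r; have := cm r; rewrite /c' ltnS.
rewrite leq_eqVlt; have [->|rr0] := eqVneq r r0.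
  by rewrite ltnn /= => _; exists j.
by rewrite (_ : (r == m :> nat) = false) //; apply: contra_neqF rr0 => /eqP rm;
  apply: val_inj.
Qed.

(** * Chains *)

Section Height.
Context (d : Order.disp_t) (P : porderType d).
Local Open Scope order_scope.

Lemma chain_Ht (C : set P) : chain C -> cle (card_of C) (Ht P).
Proof. by move=> Cch; exact: (csup_ub _ (exist _ C Cch)). Qed.

Lemma chain_max (C : set P) (J : finType) (j0 : J) (w : J -> P) :
  chain C -> (forall j, C (w j)) -> exists m, forall j, w j <= w m.
Proof.
move=> Cch Cw.
suff [m mP] : exists m, forall j, j \in enum J -> w j <= w m.
  by exists m => j; apply: mP; rewrite mem_enum.
elim: (enum J) => [|i s [m mP]]; first by exists j0.
have [im|mi] := Cch _ _ (Cw i) (Cw m).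
  by exists m => j; rewrite inE => /predU1P[->|/mP].
exists i => j; rewrite inE => /predU1P[->//|/mP jm].
exact: le_trans jm mi.
Qed.

(** Otherwise, for each j some member of the chain below c agrees with c at j.
The greatest of these finitely many members lies between each of them and c, so
it agrees with c at every j by monotonicity, and must be equal to c. *)
Lemma chain_new_coordinate (J : finType) (d' : J -> Order.disp_t)
    (Q : forall j, porderType (d' j)) (f : forall j, P -> Q j)
    (C : set P) (c0 c : P) :
    (forall j, {homo f j : x y / x <= y}) ->
    (forall x y, x <= y -> (forall j, f j x = f j y) -> x = y) ->
    chain C -> C c0 -> C c -> c0 < c ->
  exists j, forall c', C c' -> c' < c -> f j c' <> f j c.
Proof.
move=> fmono finj Cch Cc0 Cc c0c; apply: contrapT => /forallNP noj.
have /choice[w wP] j : exists x, [/\ C x, x < c & f j x = f j c].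
  have /existsNP[x /not_implyP[Cx /not_implyP[xc /contrapT fx]]] := noj j.
  by exists x.
have [j0] : inhabited J.
  apply: contrapT => J0; move: (c0c).
  rewrite (finj c0 c (ltW c0c)) ?ltxx // => j; by case: J0.
have [//|m mP] := @chain_max C J j0 w Cch; first by move=> j; case: (wP j).
have [_ wmc _] := wP m; move: (wmc).
rewrite (finj (w m) c (ltW wmc)) ?ltxx // => j.
have [_ _ fw] := wP j; apply: le_anti; rewrite (fmono _ _ _ (ltW wmc)) -fw.
exact: fmono.
Qed.

End Height.

(** * Congruences and generated subalgebras *)

Section Congruences.
Context (I : Type) (A : unary_algebra I).

Lemma congr_leP (s t : Cong A) :
  (s <= t)%O <-> forall a b, s a b -> t a b.
Proof. by split=> /asboolP. Qed.

Lemma congr_refl (s : Cong A) a : s a a.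
Proof. by case: (congr_equiv s) => r _ _; exact: r. Qed.

Lemma congr_sym (s : Cong A) a b : s a b -> s b a.
Proof. by case: (congr_equiv s) => _ r _; exact: r. Qed.

Lemma congr_trans (s : Cong A) a b c : s a b -> s b c -> s a c.
Proof. by case: (congr_equiv s) => _ _ r; exact: r. Qed.

Definition congr_bot : Cong A.
Proof.
exists (fun a b => a = b); last by move=> i a b ->.
by split=> [a//|a b //|a b c ->].
Defined.

Definition congr_top : Cong A.
Proof. by exists (fun _ _ => True). Defined.

Lemma congr_bot_le (s : Cong A) : (congr_bot <= s)%O.
Proof. by apply/congr_leP => a _ <-; exact: congr_refl. Qed.

Lemma congr_le_top (s : Cong A) : (s <= congr_top)%O.
Proof. exact/congr_leP. Qed.

Lemma chain_ends (C : set (Cong A)) :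
  chain C -> chain (C `|` [set congr_bot; congr_top]).
Proof.
move=> Cch s t [Cs|[->|->]] [Ct|[->|->]]; first exact: Cch.
all: by rewrite ?congr_bot_le ?congr_le_top; auto.
Qed.

Lemma generated_sub (a : A) (S : set A) :
  subalgebra S -> S a -> generated a `<=` S.
Proof. by move=> Ssub Sa; apply: smallest_sub => // _ ->. Qed.

Lemma generated_refl (a : A) : generated a a.
Proof. by move=> S [_ aS]; exact: aS. Qed.

Lemma generated_subalgebra (a : A) : subalgebra (generated a).
Proof.
by move=> i b ab S [Ssub aS]; exact: (Ssub i b (ab S (conj Ssub aS))).
Qed.

End Congruences.

Arguments generated_refl {I A} a.
Arguments generated_subalgebra {I A} a i.

(** * Lifting congruences from the principal factors *)

Section RankedClasses.
Context (I : Type) (A : unary_algebra I) (k : nat) (G : 'I_k -> set A).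
Context (cls : A -> 'I_k) (rank : 'I_k -> nat) (r0 : 'I_k).
Context (clsP : forall a r, (a \in G r) = (cls a == r)).
Context (cls_surj : forall r, exists a, cls a = r).
Context (cls_generated : forall a b, cls a = cls b -> generated a b).
Context (rank_inj : injective rank).
Context (rank_op : forall i a, (rank (cls (op i a)) <= rank (cls a))%N).
Context (rank_r0 : forall r, (rank r0 <= rank r)%N).

Local Notation factor r := (principal_factor (G r)).
Local Notation level a := (rank (cls a)).

(** Only meaningful for elements of level at most that of r: this is then the
quotient map that collapses A_{<r} to 0. On the elements of higher level it is
not compatible with the operations. *)
Definition collapse r (a : A) : factor r := insub a.

Lemma collapse_low r a : (level a < rank r)%N -> collapse r a = None.
Proof.
by move=> ar; apply: insubN; rewrite clsP; apply: contraTneq ar => ->;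
  rewrite ltnn.
Qed.

Lemma collapse_val r (x : G r) : collapse r (val x) = Some x.
Proof. exact: valK. Qed.

Lemma cls_val r (x : G r) : cls (val x) = r.
Proof. by apply/eqP; rewrite -clsP; exact: valP. Qed.

Lemma collapseP r a : (level a <= rank r)%N ->
  (exists2 x : G r, a = val x & collapse r a = Some x) \/
  (level a < rank r)%N /\ collapse r a = None.
Proof.
move=> ar; have [/eqP car|ncar] := boolP (cls a == r).
  have aG : a \in G r by rewrite clsP car.
  by left; exists (SigSub aG) => //; exact: (collapse_val (SigSub aG)).
suff lt : (level a < rank r)%N by right; rewrite collapse_low.
by rewrite ltn_neqAle ar andbT; apply: contraNneq ncar => /rank_inj ->.
Qed.

Lemma collapse_op r i a : (level a <= rank r)%N ->
  collapse r (op i a) = op i (collapse r a).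
Proof.
case/collapseP => [[x -> ->]//|[lt ->]].
by rewrite collapse_low // (leq_ltn_trans (rank_op i a)).
Qed.

Definition lift_rel r (s : Cong (factor r)) (a b : A) : Prop :=
  a = b \/ [/\ (level a <= rank r)%N, (level b <= rank r)%N
             & s (collapse r a) (collapse r b)].

Definition lift_congr r (s : Cong (factor r)) : Cong A.
Proof.
exists (lift_rel s).
  split=> [a|a b|a b c].
  - by left.
  - by case=> [->|[? ? /congr_sym ?]]; [left|right].
  - case=> [->//|[ar br ab]] [<-|[_ cr bc]]; right; split=> //.
    exact: congr_trans bc.
move=> i a b [->|[ar br ab]]; first by left.
right; split; [exact: leq_trans ar|exact: leq_trans br|].
by rewrite !collapse_op //; exact: congr_op.
Defined.

(** For r <> r0, the lift of equality glues A_{<r} together, which lifts from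
lower classes also achieve. For r = r0, 0 is the image of no element of A, and
the greatest congruence of the factor has the same lift as the one that merely
relates all of G r0. *)
Definition redundant_congr r : Cong (factor r) :=
  if r == r0 then congr_top _ else congr_bot _.

Lemma level_r0 a : (level a <= rank r0)%N -> cls a = r0.
Proof.
by move=> ar; apply: rank_inj; apply/eqP; rewrite eqn_leq ar rank_r0.
Qed.

(** G r0 is closed under the operations and generated by x, so relating x to 0
relates all of G r0 to 0. *)
Lemma bottom_factor_top (s : Cong (factor r0)) (x : G r0) :
  s None (Some x) -> s = congr_top _.
Proof.
move=> sx; suff s0 u : s None u.
  apply: congr_inj; apply/funext => u; apply/funext => v; apply/propext.
  by split=> // _; apply: congr_trans (s0 v); exact: congr_sym.
case: u => [y|]; last exact: congr_refl.
suff : [set a | cls a = r0 /\ s None (collapse r0 a)] (val y).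
  by rewrite /= collapse_val => -[].
apply: (@generated_sub _ _ (val x));
    last by apply: cls_generated; rewrite !cls_val.
  move=> i a [ar0 sa]; split; first by apply: level_r0; rewrite -ar0.
  by rewrite collapse_op ?ar0 //; exact: (congr_op i sa).
by split; [exact: cls_val|rewrite collapse_val].
Qed.

(** The pairs of a congruence that is not redundant can be tested on elements of
A. The point to check is u = 0: when r = r0 it has no preimage, but then s
relates it to nothing else. *)
Lemma collapse_surj r (s : Cong (factor r)) (u v : factor r) :
  s <> redundant_congr r -> s u v -> u <> v ->
  exists2 a, (level a <= rank r)%N & collapse r a = u.
Proof.
move=> sr suv uv; case: u suv uv => [x|] suv uv.
  by exists (val x); rewrite ?collapse_val ?cls_val.
have [rr0|nrr0] := eqVneq r r0.
  move: s sr v suv uv; rewrite rr0 => s sr [y /bottom_factor_top st|//] _.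
  by case: sr; rewrite st /redundant_congr eqxx.
have [a a0] := cls_surj r0.
have lt : (level a < rank r)%N.
  by rewrite a0 ltn_neqAle rank_r0 andbT (inj_eq rank_inj) eq_sym.
by exists a; [exact: ltnW|exact: collapse_low].
Qed.

Lemma lift_reflects r t (s : Cong (factor r)) (s' : Cong (factor t)) :
    s <> redundant_congr r -> (lift_congr s <= lift_congr s')%O ->
  forall u v, s u v -> u <> v ->
  exists a b, [/\ collapse r a = u, collapse r b = v,
    (level a <= rank t)%N, (level b <= rank t)%N
    & s' (collapse t a) (collapse t b)].
Proof.
move=> sr /congr_leP ss' u v suv uv.
have [a ar au] := collapse_surj sr suv uv.
have [b br bv] := collapse_surj sr (congr_sym suv) (not_eq_sym uv).
have [||[]] := ss' a b; first by right; rewrite au bv.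
  by move=> ab; case: uv; rewrite -au -bv ab.
by exists a, b.
Qed.

Lemma lift_le r (s s' : Cong (factor r)) :
  s <> redundant_congr r -> (lift_congr s <= lift_congr s')%O -> (s <= s')%O.
Proof.
move=> sr ss'; apply/congr_leP => u v suv.
have [->|uv] := EM (u = v); first exact: congr_refl.
by have [a [b [<- <- _ _]]] := lift_reflects sr ss' suv uv.
Qed.

Lemma lift_below r t (s : Cong (factor r)) (s' : Cong (factor t)) :
  (rank r < rank t)%N -> (lift_congr s <= lift_congr s')%O.
Proof.
move=> rt; apply/congr_leP => a b [->|[ar br _]]; first by left.
right; split; [exact: leq_trans (ltnW rt)|exact: leq_trans (ltnW rt)|].
by rewrite !collapse_low ?(leq_ltn_trans _ rt) //; exact: congr_refl.
Qed.

(** A pair of distinct elements related by s' has preimages in A that are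
related by the lift of s', hence by that of s. They are distinct, so their
levels are at most rank r, and both are collapsed to 0 in the factor of t. *)
Lemma lift_not_above r t (s : Cong (factor r)) (s' : Cong (factor t)) :
  (rank r < rank t)%N -> s' <> redundant_congr t ->
  ~ (lift_congr s' <= lift_congr s)%O.
Proof.
move=> rt s't le; apply: (s't); rewrite /redundant_congr ifN; last first.
  by apply: contraTneq rt => ->; rewrite -leqNgt.
apply: congr_inj; apply/funext => u; apply/funext => v; apply/propext.
split=> [suv|->]; last exact: congr_refl.
apply: contrapT => uv.
have [a [b [au bv ar br _]]] := lift_reflects s't le suv uv.
by apply: uv; rewrite -au -bv !collapse_low // (leq_ltn_trans _ rt).
Qed.

Lemma sum_chains_le (C : forall r, set (Cong (factor r))) :
  (forall r, chain (C r)) ->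
  cle (\big[cadd/czero]_(r < k) card_of (C r))
      (cadd (Ht (Cong A)) (card_of 'I_k)).
Proof.
move=> Cch.
pose D := [set s | exists r (t : Cong (factor r)), C r t /\ s = lift_congr t].
have Dch : chain D.
  move=> _ _ [r [s [Cs ->]]] [t [s' [Cs' ->]]].
  have [rt|tr|/rank_inj rt] := ltngtP (rank r) (rank t).
  - by left; exact: lift_below.
  - by right; exact: lift_below.
  case: t / rt s' Cs' => s' Cs'.
  suff mono (x y : Cong (factor r)) :
      (x <= y)%O -> (lift_congr x <= lift_congr y)%O.
    by have [/mono|/mono] := Cch r _ _ Cs Cs'; [left|right].
  move=> /congr_leP xy; apply/congr_leP => a b [->|[? ? /xy ?]].
    by left.
  by right.
rewrite csum_card_of.
apply: cle_trans (cadd_mono (chain_Ht Dch) (cle_refl _)).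
rewrite cadd_card_of; apply/cleP.
have DP r (s : C r) : lift_congr (val s) \in D.
  by apply: mem_set; exists r, (val s); split=> //; exact: set_valP.
exists (fun x => let: existT r s := x in
  if `[< val s = redundant_congr r >] then inr r
  else inl (SigSub (DP r s) : D)).
move=> [r s] [t s']; case: asboolP => sr; case: asboolP => s't //.
  move=> [rt]; case: t / rt s' s't => s' s't.
  by congr existT; apply: val_inj; rewrite sr.
move=> /(congr1 (fun x : D + 'I_k =>
  if x is inl y then val y else lift_congr (val s))) /= ss'.
have [rt|tr|/rank_inj rt] := ltngtP (rank r) (rank t).
- by case: (lift_not_above (s := val s) rt s't); rewrite -ss'.
- by case: (lift_not_above (s := val s') tr sr); rewrite ss'.
case: t / rt s' s't ss' => s' s't ss'; congr existT; apply: val_inj.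
by apply: le_anti; rewrite !lift_le // ss'.
Qed.

(** * Restricting congruences to the principal factors *)

Definition merged_below r (s : Cong A) (u : factor r) : Prop :=
  if u is Some x then exists2 c, (level c < rank r)%N & s (val x) c else True.

(** The first case makes the relation transitive: distinct elements of G r can be
linked through 0 without being related by s. *)
Definition res_rel r (s : Cong A) (u v : factor r) : Prop :=
  merged_below s u /\ merged_below s v \/
  (if u is Some x then if v is Some y then s (val x) (val y) else False
   else False).

Definition res_congr r (s : Cong A) : Cong (factor r).
Proof.
exists (@res_rel r s).
  split=> [[x|]|u v|u v w].
  - by right; exact: congr_refl.
  - by left.
  - case=> [[? ?]|]; first by left.
    by case: u v => [x|] [y|] //; right; exact: congr_sym.
  have move_below x y : s (val x) (val y) ->
      merged_below (r := r) s (Some x) -> merged_below (r := r) s (Some y).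
    move=> xy [c lt xc]; exists c => //.
    by apply: congr_trans xc; exact: congr_sym.
  case=> [[um vm]|].
    case=> [[_ wm]|]; first by left.
    case: v w vm => [x|] [y|] // vm xy; left; split=> //.
    exact: move_below vm.
  case: u v => [x|] [y|] // xy [[ym wm]|].
    by left; split=> //; exact: move_below (congr_sym xy) ym.
  by case: w => [z|] // yz; right; exact: congr_trans yz.
have op_level i (x : G r) : (level (op i (val x)) <= rank r)%N.
  by rewrite (leq_trans (rank_op i _)) ?cls_val.
have below_op i u : merged_below (r := r) s u ->
    merged_below (r := r) s (op i u).
  case: u => [x|//] [c lt xc].
  change (merged_below s (collapse r (op i (val x)))).
  have [[y opx ->]|[_ ->]//] := collapseP (op_level i x).
  exists (op i c); first exact: leq_ltn_trans lt.
  by rewrite -opx; exact: congr_op.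
move=> i u v [[um vm]|]; first by left; split; exact: below_op.
case: u v => [x|] [y|] // xy; have := congr_op i xy.
change (s (op i (val x)) (op i (val y)) ->
  res_rel s (collapse r (op i (val x))) (collapse r (op i (val y)))).
have [[x' -> ->]|[ltx ->]] := collapseP (op_level i x);
    have [[y' -> ->]|[lty ->]] := collapseP (op_level i y) => op_xy.
- by right.
- by left; split=> //; exists (op i (val y)).
- by left; split=> //; exists (op i (val x)) => //; exact: congr_sym.
- by left.
Defined.

Lemma res_congr_mono r : {homo res_congr r : s t / (s <= t)%O}.
Proof.
move=> s t /congr_leP st; apply/congr_leP.
have mono u : merged_below (r := r) s u -> merged_below (r := r) t u.
  by case: u => // x [c lt /st xc]; exists c.
move=> u v [[/mono um /mono vm]|]; first by left.
by case: u v => [x|] [y|] // /st; right.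
Qed.

(** By induction on a strict bound n for the levels of a and b, where t a b and
level b <= level a. The restrictions to the factor of a either give s a b, or
show that a, and b if it has the same level, is s-related to an element of
smaller level. As s is contained in t, t relates these replacements of a and b,
and the induction hypothesis applies to them. *)
Lemma res_congr_inj (s t : Cong A) : (s <= t)%O ->
  (forall r, res_congr r s = res_congr r t) -> s = t.
Proof.
move=> st res_st; apply: le_anti; rewrite st /=; apply/congr_leP.
suff below n a b : (level a < n)%N -> (level b < n)%N -> t a b -> s a b.
  move=> a b; apply: (below (maxn (level a) (level b)).+1).
    by rewrite ltnS leq_maxl.
  by rewrite ltnS leq_maxr.
elim: n a b => // n IHn.
suff main a b : (level b <= level a)%N -> (level a < n.+1)%N ->
    t a b -> s a b.
  move=> a b an bn ab; have [ba|/ltnW ba] := leqP (level b) (level a).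
    exact: main.
  by apply: congr_sym; apply: main => //; exact: congr_sym.
rewrite ltnS leq_eqVlt => /predU1P[ba an ab|ba an ab].
- have car : cls b = cls a by exact: rank_inj.
  have aG : a \in G (cls a) by rewrite clsP.
  have bG : b \in G (cls a) by rewrite clsP car.
  have : res_congr (cls a) t (Some (SigSub aG)) (Some (SigSub bG)) by right.
  rewrite -res_st => -[[[c /= cl ac] [c' /= cl' bc']]|//].
  apply: (congr_trans ac); apply: (congr_trans _ (congr_sym bc')).
  move/congr_leP: st => st.
  apply: IHn; [exact: leq_trans an|exact: leq_trans an|].
  apply: (congr_trans (congr_sym (st _ _ ac))).
  exact: (congr_trans ab (st _ _ bc')).
- have aG : a \in G (cls a) by rewrite clsP.
  have : res_congr (cls a) t (Some (SigSub aG)) None.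
    by left; split=> //; exists b.
  rewrite -res_st => -[[[c /= cl ac] _]|//].
  apply: (congr_trans ac).
  move/congr_leP: st => st.
  apply: IHn; [exact: leq_trans an|exact: leq_trans an|].
  by apply: (congr_trans (congr_sym (st _ _ ac))).
Qed.

Lemma res_congr_bot r : res_congr r (congr_bot A) = congr_bot _.
Proof.
apply: congr_inj; apply/funext => u; apply/funext => v; apply/propext.
have no_merge x : ~ merged_below (r := r) (congr_bot A) (Some x).
  by move=> [c /= + xc]; rewrite -xc cls_val ltnn.
split=> [|->]; last exact: congr_refl.
case: u v => [x|] [y|] //= [[]|] //.
- by move=> /no_merge.
- by move=> /val_inj ->.
- by move=> /no_merge.
by move=> _ /no_merge.
Qed.

(** A_{<r0} is empty, so no element of G r0 is merged with 0. *)
Lemma res_congr_r0 (s : Cong A) : res_congr r0 s <> congr_top _.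
Proof.
have [a a0] := cls_surj r0; have aG : a \in G r0 by rewrite clsP a0.
move=> top; have : res_congr r0 s None (Some (SigSub aG)) by rewrite top.
by move=> [[_ [c]]|//]; rewrite ltnNge rank_r0.
Qed.

Lemma bot_neq_top_r0 : congr_bot (factor r0) <> congr_top _.
Proof. by rewrite -res_congr_bot; exact: res_congr_r0. Qed.

Lemma chain_le (C : set (Cong A)) : chain C ->
  cle (cadd (card_of C) (card_of 'I_k))
      (\big[cadd/czero]_(r < k) Ht (Cong (factor r))).
Proof.
move=> Cch.
pose E r : set (Cong (factor r)) :=
  (res_congr r @` C) `|` [set congr_bot _; congr_top _].
have Ech r : chain (E r).
  apply: chain_ends => _ _ [s Cs <-] [t Ct <-].
  by have [st|ts] := Cch _ _ Cs Ct; [left|right]; exact: res_congr_mono.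
apply: (@cle_trans _ (\big[cadd/czero]_(r < k) card_of (E r))); last first.
  by apply: (big_ind2 cle (cle_refl _) cadd_mono) => r _; exact: chain_Ht.
rewrite csum_card_of cadd_card_of; apply/cleP.
(* Equality is added to C so that a coordinate that is new for s also differs
   from the restriction of equality, the least congruence of the factor. *)
pose C0 := C `|` [set congr_bot A; congr_top A].
have C0ch : chain C0 by exact: chain_ends.
pose spec (s : Cong A) (x : {r & E r}) := let: existT r t := x in
  if `[< s = congr_bot A >] then r = r0 /\ val t = congr_top _
  else [/\ val t = res_congr r s, val t <> congr_bot _
          & forall s', C s' -> (s' < s)%O -> res_congr r s' <> res_congr r s].
have Ebot r : congr_bot _ \in E r by apply: mem_set; right; left.
have Etop r : congr_top _ \in E r by apply: mem_set; right; right.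
have [f fP] : {f : C -> {r & E r} & forall s, spec (val s) (f s)}.
  apply: (@choice _ _ (fun s => spec (val s))) => s; have Cs := set_valP s.
  have [s0|s0] := EM (val s = congr_bot A).
    by exists (existT E r0 (SigSub (Etop r0))); rewrite /= asboolT.
  have [|||r rnew] := @chain_new_coordinate _ _ _ _ _ res_congr C0
    (congr_bot A) (val s) res_congr_mono res_congr_inj C0ch.
  - by right; left.
  - by left.
  - by rewrite lt_neqAle congr_bot_le andbT; apply/eqP => /esym.
  have Es : res_congr r (val s) \in E r by apply: mem_set; left; exists (val s).
  exists (existT E r (SigSub Es)); rewrite /= asboolF //; split=> //.
    rewrite -res_congr_bot => /esym; apply: rnew; first by right; left.
    by rewrite lt_neqAle congr_bot_le andbT; apply/eqP => /esym.
  by move=> s' Cs'; apply: rnew; left.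
have f_not_bot r s : f s <> existT E r (SigSub (Ebot r)).
  move=> fs; have := fP s; rewrite fs /=; case: asboolP => _.
    by case=> ->; exact: bot_neq_top_r0.
  by case.
have f_inj : injective f.
  move=> s t fst; have := fP t; have := fP s; rewrite -fst.
  case: (f s) => r x /=; case: asboolP => s0; case: asboolP => t0.
  - by move=> _ _; apply: val_inj; exact: etrans s0 (esym t0).
  - move=> [rr0 xtop] [xt _ _]; case: (@res_congr_r0 (val t)).
    by rewrite -rr0 -xt.
  - move=> [xs _ _] [rr0 xtop]; case: (@res_congr_r0 (val s)).
    by rewrite -rr0 -xs.
  move=> [xs _ snew] [xt _ tnew]; apply: val_inj.
  have Cs := set_valP s; have Ct := set_valP t.
  apply: contrapT => /eqP st_neq.
  have [st|ts] := Cch _ _ Cs Ct.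
    by apply: (tnew _ Cs); rewrite ?lt_neqAle ?st_neq // -xs.
  by apply: (snew _ Ct); rewrite ?lt_neqAle 1?eq_sym ?st_neq // -xs.
exists (fun x => match x with
  | inl s => f s | inr r => existT E r (SigSub (Ebot r)) end).
move=> [s|r] [t|r'] /=.
- by move=> /f_inj ->.
- by move=> /f_not_bot.
- by move=> /esym/f_not_bot.
- by move=> /(congr1 (@projT1 _ _)) /= ->.
Qed.

End RankedClasses.

(** * Ranking the classes *)

Section Ranking.
Context (I : Type) (A : unary_algebra I) (k : nat) (G : 'I_k -> set A).
Context (G_inj : injective G) (G_classes : range G = Gclasses A).

Lemma class_eq r a : G r a -> G r = [set b | Grel a b].
Proof.
move=> ra; have : Gclasses A (G r) by rewrite -G_classes; exists r.
by move=> [b _ bG]; move: ra; rewrite -bG /= /Grel => ->.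
Qed.

Lemma class_map : exists cls : A -> 'I_k,
  [/\ forall a r, (a \in G r) = (cls a == r),
      forall r, exists a, cls a = r
    & forall a b, cls a = cls b <-> generated a = generated b].
Proof.
have /choice[cls clsG] a : exists r, G r a.
  have : range G [set b | Grel a b] by rewrite G_classes; exists a.
  by move=> [r _ rG]; exists r; rewrite rG.
have clsE a r : G r a -> cls a = r.
  by move=> ra; apply: G_inj; rewrite (class_eq ra) -(class_eq (clsG a)).
exists cls; split=> [a r|r|a b].
- by apply/idP/eqP => [/set_mem/clsE//|<-]; exact: mem_set.
- have : Gclasses A (G r) by rewrite -G_classes; exists r.
  by move=> [a _ aG]; exists a; apply: clsE; rewrite -aG.
- split=> [ab|ab].
    by have := clsG b; rewrite -ab (class_eq (clsG a)).
  by apply/esym/clsE; rewrite (class_eq (clsG a)).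
Qed.

(** Applying an operation to a shrinks the set of classes that meet the
subalgebra generated by a, and strictly so when the class of a is left. The
number of these classes is therefore monotone; the remainder modulo k breaks
ties between distinct classes. *)
Lemma class_rank (cls : A -> 'I_k) :
    (forall r, exists a, cls a = r) ->
    (forall a b, cls a = cls b <-> generated a = generated b) ->
  exists rank : 'I_k -> nat, injective rank /\
    forall i a, (rank (cls (op i a)) <= rank (cls a))%N.
Proof.
move=> cls_surj clsE.
pose down r := [set s | `[< exists a b,
  [/\ cls a = r, cls b = s & generated a b] >]]%SET.
pose rank r := (#|down r| * k + r)%N.
have modk r : (rank r %% k)%N = r by rewrite modnMDl modn_small.
exists rank; split=> [r s rs|i a].
  by apply: val_inj; rewrite /= -(modk r) -(modk s) rs.
have [->//|neq] := eqVneq (cls (op i a)) (cls a).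
have sub : generated (op i a) `<=` generated a.
  apply: generated_sub; first exact: generated_subalgebra.
  exact: (generated_subalgebra a i a (generated_refl a)).
suff lt : (#|down (cls (op i a))| < #|down (cls a)|)%N.
  apply: ltnW; apply: (@leq_trans (#|down (cls (op i a))|.+1 * k)).
    by rewrite mulSnr -addnS leq_add2l.
  by rewrite (leq_trans _ (leq_addr _ _)) // leq_mul2r lt orbT.
apply: proper_card; apply/properP; split.
  apply/fintype.subsetP => s; rewrite !inE => -[b [c [/clsE ba cs bc]]].
  by exists a, c; split=> //; apply: sub; rewrite -ba.
exists (cls a); rewrite !inE.
  by exists a, a; split=> //; exact: generated_refl.
apply/negP; rewrite !inE => -[b [c [/clsE ba /clsE ca bc]]].
move/eqP: neq; apply; apply/clsE/seteqP; split=> //.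
rewrite -ba; apply: generated_sub; first exact: generated_subalgebra.
apply: (generated_sub (generated_subalgebra b) bc).
by rewrite ca; exact: generated_refl.
Qed.

End Ranking.

Theorem theorem4p4 (I : Type) (A : unary_algebra I) (k : nat)
    (G : 'I_k -> set A) (k_gt0 : (0 < k)%N)
    (G_inj : injective G) (G_classes : range G = Gclasses A) :
  Ht (Cong A) = (\sum_(r < k) Ht (Cong (principal_factor (G r))) - k)%cardinal.
Proof.
have [cls [clsP cls_surj clsE]] := class_map G_inj G_classes.
have [rank [rank_inj rank_op]] := class_rank cls_surj clsE.
have cls_generated a b : cls a = cls b -> generated a b.
  by move=> /clsE ->; exact: generated_refl.
have [r0 _ rank_r0] := arg_minnP rank (erefl : xpredT (Ordinal k_gt0)).
have {}rank_r0 r : (rank r0 <= rank r)%N by exact: rank_r0.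
apply: cle_anti; last first.
  apply: csub_le; apply: csum_csup_le => [r|C].
    (* The empty set is a chain. *)
    by constructor; exists set0.
  exact: (sum_chains_le clsP cls_surj cls_generated rank_inj rank_op rank_r0
    (fun r => svalP (C r))).
apply: csup_le => -[C Cch] /=; apply: (@cadd_ord_cancel _ _ k).
apply: cle_trans (csubK _ _).
exact: (chain_le clsP cls_surj rank_inj rank_op rank_r0 Cch).
Qed.
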